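(* Let $A$ be an algebra with differential calculus, and let $(E^m,\nabla)\in{}_A\mathcal{F}$, $m\ge0$, be a family of $A$-bimodules with flat left connections equipped with a product structure $(\sigma,\wedge)$. Then $\nabla^{[*]}$ is a graded derivation over the product $(\xi\otimes e)\wedge(\eta\otimes f)=(-1)^{|e||\eta|}\xi\wedge\sigma(e\otimes\eta)\wedge f$ on $\Omega^*A\otimes_AE^*$, i.e. $$\nabla^{[*]}((\xi\otimes e)\wedge(\eta\otimes f))=\nabla^{[*]}(\xi\otimes e)\wedge(\eta\otimes f)+(-1)^{|\xi|+|e|}(\xi\otimes e)\wedge\nabla^{[*]}(\eta\otimes f).$$ Thus there is an induced product structure on the cohomology, $$\wedge:H^n(A,E^m,\nabla)\otimes H^{n'}(A,E^{m'},\nabla)\to H^{n+n'}(A,E^{m+m'},\nabla).$$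
   Context: Algebras are unital over a field $k$. A differential calculus on $A$ is a differential graded algebra $(\mathrm{d},\Omega^*A)$ with $\Omega^0A=A$ and product $\wedge$ (satisfying the density condition $\Omega^{n+1}A\subset A.\mathrm{d}\Omega^nA$). A left connection on a left $A$-module $E$ is a linear map $\nabla:E\to\Omega^1A\otimes_AE$ with $\nabla(a.e)=\mathrm{d}a\otimes e+a\nabla e$. Put $\nabla^{[*]}(\xi\otimes e)=\mathrm{d}\xi\otimes e+(-1)^{|\xi|}\xi\wedge\nabla e$ on $\Omega^*A\otimes_AE$. The connection is flat if $\nabla^{[1]}\nabla=0$; ${}_A\mathcal{F}$ is the category of left $A$-modules with flat connection, and $H^*(A,E,\nabla)$ is the cohomology of $(\Omega^*A\otimes_AE,\nabla^{[*]})$. Product structure: let $(E^m,\nabla)\in{}_A\mathcal{F}$ for all $m\ge0$, each $E^m$ an $A$-bimodule, with $|e|=m$ for $e\in E^m$. A product structure on this family consists of (1) $A$-bimodule maps $\sigma:E^m\otimes_A\Omega^nA\to\Omega^nA\otimes_AE^m$, and (2) a product $\wedge:E^m\otimes_AE^{m'}\to E^{m+m'}$, such that for all $e,f\in E^*$ and $\xi,\eta\in\Omega^*A$: (a) the product $(\xi\otimes e)\wedge(\eta\otimes f)=(-1)^{|e||\eta|}\xi\wedge\sigma(e\otimes\eta)\wedge f$ on $\Omega^*A\otimes_AE^*$ is associative; (b) $(\mathrm{id}\wedge\sigma)(\nabla e\otimes\xi)+\sigma(e\otimes\mathrm{d}\xi)=[\mathrm{d}\otimes\mathrm{id}+(-1)^{|\xi|}(\mathrm{id}\wedge\nabla)]\sigma(e\otimes\xi)$;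 (c) $\nabla(e\wedge f)=\nabla e\wedge f+(\sigma\wedge\mathrm{id})(e\otimes\nabla f)$; (d) $(\mathrm{id}\wedge\sigma)(\sigma(e\otimes\xi)\otimes\eta)=\sigma(e\otimes(\xi\wedge\eta))$. In these formulas $\wedge$ between forms is the product of $\Omega^*A$, and $\wedge$ between elements of $E^*$ is the product (2), applied to the $E$-factors. *)

(* Defs.v *)
From HB Require Import structures.
From mathcomp Require Import all_boot all_algebra.
From mathcomp Require Import generic_quotient ring_quotient.
From mathcomp Require Import boolp.
From mathcomp Require Import freeg.

Set Implicit Arguments.
Unset Strict Implicit.
Unset Printing Implicit Defensive.

Import GRing.Theory.
Local Open Scope ring_scope.
Local Open Scope quotient_scope.

Section QuotientModule.
Variables (k : fieldType) (V : lmodType k) (S : pred V).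
Hypothesis S_closed : submod_closed S.

Definition submod_pred of submod_closed S : pred V := S.
HB.instance Definition _ :=
  GRing.isSubmodClosed.Build k V (submod_pred S_closed) S_closed.
Local Notation I := (GRing.ZmodClosed.clone V (submod_pred S_closed) _).

Definition quotmod : Type := Quotient.quot I.
HB.instance Definition _ := GRing.Zmodule.on quotmod.

Definition quotcls (x : V) : quotmod := \pi_(Quotient.quot I) x.

Lemma quotclsP (x y : V) : reflect (quotcls x = quotcls y) (x - y \in S).
Proof. by rewrite -[S]/(submod_pred S_closed : pred V) Quotient.idealrBE; apply: (iffP eqP). Qed.

Lemma quotclsK (x : quotmod) : quotcls (repr x) = x.
Proof. exact: reprK. Qed.

Lemma quotclsD (x y : V) : quotcls (x + y) = quotcls x + quotcls y.
Proof. exact: raddfD. Qed.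

Definition quotscale (c : k) (x : quotmod) : quotmod := quotcls (c *: repr x).

Lemma quotscaleE c x : quotscale c (quotcls x) = quotcls (c *: x).
Proof.
by apply/quotclsP; rewrite -scalerBr -[S]/(submod_pred S_closed : pred V) rpredZ //; apply/quotclsP/quotclsK.
Qed.

Lemma quotmod_ind (P : quotmod -> Prop) :
  (forall v, P (quotcls v)) -> forall x, P x.
Proof. by move=> Pv x; rewrite -[x]quotclsK. Qed.

Lemma quotscaleA a b v : quotscale a (quotscale b v) = quotscale (a * b) v.
Proof. by elim/quotmod_ind: v => v; rewrite !quotscaleE scalerA. Qed.
Lemma quotscale1 : left_id 1 quotscale.
Proof. by elim/quotmod_ind=> v; rewrite quotscaleE scale1r. Qed.
Lemma quotscaleDr : right_distributive quotscale +%R.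
Proof.
move=> c; elim/quotmod_ind=> u; elim/quotmod_ind=> v.
by rewrite -quotclsD !quotscaleE scalerDr quotclsD.
Qed.
Lemma quotscaleDl v : {morph quotscale^~ v : a b / a + b}.
Proof.
by move=> a b; elim/quotmod_ind: v => v; rewrite !quotscaleE scalerDl quotclsD.
Qed.

HB.instance Definition _ := GRing.Zmodule_isLmodule.Build k quotmod
  quotscaleA quotscale1 quotscaleDr quotscaleDl.

Lemma quotcls_linear : linear quotcls.
Proof.
move=> c u v; rewrite quotclsD; congr (_ + _); exact/esym/quotscaleE.
Qed.
HB.instance Definition _ :=
  GRing.isLinear.Build k V quotmod *:%R quotcls quotcls_linear.

Section Lift.
Variables (W : lmodType k) (f : {linear V -> W}).
Hypothesis fI : forall x, x \in S -> f x = 0.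

Definition quotlift_fun (x : quotmod) : W := f (repr x).

Lemma quotlift_funE v : quotlift_fun (quotcls v) = f v.
Proof.
apply/eqP; rewrite -subr_eq0 -linearB; apply/eqP/fI.
exact/quotclsP/quotclsK.
Qed.

Lemma quotlift_linear : linear quotlift_fun.
Proof.
move=> c; elim/quotmod_ind=> u; elim/quotmod_ind=> v.
by rewrite -linearP !quotlift_funE linearP.
Qed.
HB.instance Definition _ :=
  GRing.isLinear.Build k quotmod W *:%R quotlift_fun quotlift_linear.
Definition quotlift : {linear quotmod -> W} := quotlift_fun.

Lemma quotliftE v : quotlift (quotcls v) = f v.
Proof. exact: quotlift_funE. Qed.
End Lift.

End QuotientModule.

Arguments quotcls {k V S} S_closed x.

Section Modules.
Variables (k : fieldType) (A : algType k).

(* Modules over the k-algebra A are k-vector spaces with a k-bilinear action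
   of A, so that the two actions on a bimodule induce the same k-action. *)
Record leftModule := LeftModule {
  lmod_sort :> lmodType k;
  lact : A -> lmod_sort -> lmod_sort;
  lact_linearl : forall x, linear (lact^~ x);
  lact_linearr : forall a, linear (lact a);
  lact1 : forall x, lact 1 x = x;
  lactM : forall a b x, lact (a * b) x = lact a (lact b x)
}.

Record bimodule := Bimodule {
  bimod_left :> leftModule;
  ract : bimod_left -> A -> bimod_left;
  ract_linearl : forall a, linear (ract^~ a);
  ract_linearr : forall x, linear (ract x);
  ract1 : forall x, ract x 1 = x;
  ractM : forall a b x, ract x (a * b) = ract (ract x a) b;
  lract : forall a b x, lact a (ract x b) = ract (lact a x) b
}.

Record lmodHom (M N : leftModule) := LmodHom {
  lmodHom_fun :> {linear M -> N};
  lmodHomE : forall a x, lmodHom_fun (lact a x) = lact a (lmodHom_fun x)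
}.

Record bimodHom (M N : bimodule) := BimodHom {
  bimodHom_fun :> {linear M -> N};
  bimodHomEl : forall a x, bimodHom_fun (lact a x) = lact a (bimodHom_fun x);
  bimodHomEr : forall a x, bimodHom_fun (ract x a) = ract (bimodHom_fun x) a
}.

Record balanced (M : bimodule) (N : leftModule) (V : lmodType k) := Balanced {
  bal_fun :> M -> N -> V;
  bal_linearl : forall y, linear (bal_fun^~ y);
  bal_linearr : forall x, linear (bal_fun x);
  balA : forall x a y, bal_fun (ract x a) y = bal_fun x (lact a y)
}.

End Modules.

Section Tensor.
Variables (k : fieldType) (A : algType k).

Section Construction.
Variables (M : bimodule A) (N : leftModule A).

Let F : lmodType k := {freeg (M * N)%type / k}.
Local Notation "[ x , y ]" := (<< ((x, y) : (M * N)%type) >> : F).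

Inductive tens_rel : F -> Prop :=
| tens_rel_linearl c x x' y : tens_rel ([c *: x + x', y] - (c *: [x, y] + [x', y]))
| tens_rel_linearr c x y y' : tens_rel ([x, c *: y + y'] - (c *: [x, y] + [x, y']))
| tens_rel_bal x a y : tens_rel ([ract x a, y] - [x, lact a y])
| tens_rel_0 : tens_rel 0
| tens_rel_P c u v : tens_rel u -> tens_rel v -> tens_rel (c *: u + v).

Definition tens_relb : pred F := fun u => `[< tens_rel u >].

Lemma tens_relb_closed : submod_closed tens_relb.
Proof.
split; first by apply/asboolP; constructor.
by move=> c u v /asboolP ru /asboolP rv; apply/asboolP; constructor.
Qed.

Definition tens_space : lmodType k := quotmod tens_relb_closed.
Definition tensor (x : M) (y : N) : tens_space := quotcls tens_relb_closed [x, y].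

Lemma tensor_linearl y : linear (tensor^~ y).
Proof.
move=> c x x'; rewrite /tensor -linearP.
by apply/quotclsP/asboolP; constructor.
Qed.

Lemma tensorDl x x' y : tensor (x + x') y = tensor x y + tensor x' y.
Proof. by have := tensor_linearl y 1 x x'; rewrite !scale1r. Qed.

Lemma tensor_linearr x : linear (tensor x).
Proof.
move=> c y y'; rewrite /tensor -linearP.
by apply/quotclsP/asboolP; constructor.
Qed.

Lemma tensorZl c x y : tensor (c *: x) y = c *: tensor x y.
Proof.
have t0 : tensor 0 y = 0.
  by apply: (addIr (tensor 0 y)); rewrite -tensorDl !add0r.
by have := tensor_linearl y c x 0; rewrite t0 !addr0.
Qed.

Lemma tensorA x a y : tensor (ract x a) y = tensor x (lact a y).
Proof. by apply/quotclsP/asboolP; constructor. Qed.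

Definition tensor_bal : balanced M N tens_space :=
  Balanced tensor_linearl tensor_linearr tensorA.

Section Lift.
Variables (V : lmodType k) (f : balanced M N V).

Let g : F -> V := fglift (fun xy => f xy.1 xy.2).
Let g_zmod : zmod_morphism g. Proof. exact: lift_is_additive. Qed.
HB.instance Definition _ := GRing.isZmodMorphism.Build F V g g_zmod.

Let g_scalable : scalable g.
Proof.
move=> c u; rewrite (_ : c *: u = fgscale c u) // /fgscale raddf_sum.
rewrite -[in RHS](freeg_sumE u) raddf_sum scaler_sumr.
by apply: eq_bigr => xy _; rewrite /= /g !liftU scalerA.
Qed.
HB.instance Definition _ := GRing.isScalable.Build k F V *:%R g g_scalable.

Let gE x y : g [x, y] = f x y.
Proof. by rewrite /g liftU scale1r. Qed.

Let g_rel u : u \in tens_relb -> g u = 0.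
Proof.
move/asboolP; elim=> [c x x' y|c x y y'|x a y||c u' v _ gu _ gv].
- by rewrite raddfB /= linearP /= !gE (bal_linearl f y c x x') subrr.
- by rewrite raddfB /= linearP /= !gE (bal_linearr f x c y y') subrr.
- by rewrite raddfB /= !gE balA subrr.
- exact: raddf0.
- by rewrite linearP /= gu gv scaler0 addr0.
Qed.

Fact tens_lift_subproof :
  {h : {linear tens_space -> V} | forall x y, h (tensor x y) = f x y}.
Proof.
exists (quotlift tens_relb_closed g_rel) => x y.
by rewrite /tensor quotliftE; apply: gE.
Qed.

Definition tens_lift : {linear tens_space -> V} := sval tens_lift_subproof.

Lemma tens_liftE x y : tens_lift (tensor x y) = f x y.
Proof. exact: (svalP tens_lift_subproof). Qed.
End Lift.

Lemma tens_ind (P : tens_space -> Prop) :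
  P 0 -> (forall x y, P (tensor x y)) ->
  (forall c u v, P u -> P v -> P (c *: u + v)) -> forall u, P u.
Proof.
move=> P0 Pt Ps; elim/quotmod_ind => u; rewrite -(freeg_sumE u).
elim: (dom u) => [|[x y] s IHs]; first by rewrite big_nil linear0.
rewrite big_cons linearD.
suff -> : << coeff (x, y) u *g (x, y) >> = coeff (x, y) u *: [x, y] :> F.
  by rewrite linearZ; apply: Ps => //; apply: Pt.
by apply/eqP/freeg_eqP => z; rewrite coeff_fgscale !coeffU mul1r.
Qed.

Lemma tens_ext (V : lmodType k) (f g : {linear tens_space -> V}) :
  (forall x y, f (tensor x y) = g (tensor x y)) -> f =1 g.
Proof.
move=> fg; elim/tens_ind => [|x y|c u v fu fv]; rewrite ?linear0 //.
by rewrite !linearP fu fv.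
Qed.
End Construction.

Arguments tensor {M N} x y.
Arguments tens_lift : simpl never.

Section LeftAction.
Variables (M : bimodule A) (N : leftModule A).

Section Act.
Variable a : A.
Let f (x : M) (y : N) := tensor (lact a x) y.
Let f_linearl y : linear (f^~ y).
Proof. by move=> c x x'; rewrite /f lact_linearr tensor_linearl. Qed.
Let f_linearr x : linear (f x).
Proof. by move=> c y y'; rewrite /f tensor_linearr. Qed.
Let f_bal x b y : f (ract x b) y = f x (lact b y).
Proof. by rewrite /f lract tensorA. Qed.
Definition tens_lact : {linear tens_space M N -> tens_space M N} :=
  tens_lift (Balanced f_linearl f_linearr f_bal).
Lemma tens_lactE x y : tens_lact (tensor x y) = tensor (lact a x) y.
Proof. exact: tens_liftE. Qed.
End Act.
Arguments tens_lact : simpl never.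

Let act_linearl u : linear (tens_lact^~ u).
Proof.
move=> c a b; elim/tens_ind: u => [|x y|e u v IHu IHv].
- by rewrite !linear0 addr0.
- by rewrite !tens_lactE lact_linearl tensor_linearl.
- by rewrite !linearP IHu IHv /= !scalerDr !scalerA addrACA mulrC.
Qed.

Let act1 u : tens_lact 1 u = u.
Proof.
elim/tens_ind: u => [|x y|e u v IHu IHv]; first by rewrite linear0.
  by rewrite tens_lactE lact1.
by rewrite linearP IHu IHv.
Qed.

Let actM a b u : tens_lact (a * b) u = tens_lact a (tens_lact b u).
Proof.
elim/tens_ind: u => [|x y|e u v IHu IHv]; first by rewrite !linear0.
  by rewrite !tens_lactE lactM.
by rewrite !linearP IHu IHv.
Qed.

Definition tens : leftModule A :=
  @LeftModule k A (tens_space M N) tens_lact act_linearl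
    (fun a => linearP (tens_lact a)) act1 actM.

Lemma lact_tensor a x y : lact a (tensor x y : tens) = tensor (lact a x) y.
Proof. exact: tens_lactE. Qed.
End LeftAction.

Section RightAction.
Variables (M N : bimodule A).

Section Act.
Variable a : A.
Let f (x : M) (y : N) := tensor x (ract y a).
Let f_linearl y : linear (f^~ y).
Proof. by move=> c x x'; rewrite /f tensor_linearl. Qed.
Let f_linearr x : linear (f x).
Proof. by move=> c y y'; rewrite /f ract_linearl tensor_linearr. Qed.
Let f_bal x b y : f (ract x b) y = f x (lact b y).
Proof. by rewrite /f tensorA lract. Qed.
Definition tens_ract : {linear tens M N -> tens M N} :=
  tens_lift (Balanced f_linearl f_linearr f_bal).
Lemma tens_ractE x y : tens_ract (tensor x y) = tensor x (ract y a).
Proof. exact: tens_liftE. Qed.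
End Act.
Arguments tens_ract : simpl never.

Let act_linearr u : linear (tens_ract^~ u).
Proof.
move=> c a b; elim/tens_ind: u => [|x y|e u v IHu IHv].
- by rewrite !linear0 addr0.
- by rewrite !tens_ractE ract_linearr tensor_linearr.
- by rewrite !linearP IHu IHv /= !scalerDr !scalerA addrACA mulrC.
Qed.

Let act1 u : tens_ract 1 u = u.
Proof.
elim/tens_ind: u => [|x y|e u v IHu IHv]; first by rewrite linear0.
  by rewrite tens_ractE ract1.
by rewrite linearP IHu IHv.
Qed.

Let actM a b u : tens_ract (a * b) u = tens_ract b (tens_ract a u).
Proof.
elim/tens_ind: u => [|x y|e u v IHu IHv]; first by rewrite !linear0.
  by rewrite !tens_ractE ractM.
by rewrite !linearP IHu IHv.
Qed.

Let actA a b u : lact a (tens_ract b u : tens M N) = tens_ract b (lact a u).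
Proof.
have lactE : lact (l := tens M N) a = tens_lact M N a by [].
rewrite lactE; elim/tens_ind: u => [|x y|e u v IHu IHv].
- by rewrite !linear0.
- by rewrite tens_ractE !tens_lactE tens_ractE.
- by rewrite !linearP IHu IHv.
Qed.

Definition btens : bimodule A :=
  @Bimodule k A (tens M N) (fun u a => tens_ract a u)
    (fun a => linearP (tens_ract a)) act_linearr act1 actM actA.

Lemma ract_tensor a x y : ract (tensor x y : btens) a = tensor x (ract y a).
Proof. exact: tens_ractE. Qed.
End RightAction.

End Tensor.

Arguments tensor {k A M N} x y.
Arguments tens_lift : simpl never.
Arguments tens_lact : simpl never.
Arguments tens_ract : simpl never.

(* Tensor products over k are the case A = k of the above. *)
Section TensorK.
Variable k : fieldType.

Section Trivial.
Variable V : lmodType k.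
Let sl (v : V) : linear (fun c : k^o => c *: v).
Proof. by move=> c a b; rewrite scalerDl scalerA. Qed.
Let sr (c : k^o) : linear (fun v : V => c *: v).
Proof. by move=> a u v; rewrite scalerDr !scalerA mulrC. Qed.
Let sM (a b : k^o) (v : V) : (a * b) *: v = b *: (a *: v).
Proof. by rewrite scalerA mulrC. Qed.
Let sC (a b : k^o) (v : V) : a *: (b *: v) = b *: (a *: v).
Proof. by rewrite !scalerA mulrC. Qed.
Definition vect_left : leftModule k^o :=
  @LeftModule k k^o V (fun c v => c *: v) sl sr (@scale1r k V)
    (fun a b v => esym (scalerA a b v)).
Definition vect : bimodule k^o :=
  @Bimodule k k^o vect_left (fun v c => c *: v) sr sl (@scale1r k V) sM sC.
End Trivial.

Definition tensk (V W : lmodType k) : lmodType k := tens (vect V) (vect W).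
Definition tensork (V W : lmodType k) (v : V) (w : W) : tensk V W :=
  @tensor k k^o (vect V) (vect W) v w.
End TensorK.

Section Calculus.
Variables (k : fieldType) (A : algType k).

(* [form n] is Omega^n A and [form0] the identification of A with Omega^0 A.
   The degree of a product is passed with a proof of [n + m = p], which
   avoids transports along the equalities of degrees; by [eq_irrelevance] the
   product does not depend on that proof. *)
Record calculus := Calculus {
  form : nat -> lmodType k;
  form0 : {linear A -> form 0};
  wedge : forall n m p, (n + m)%N = p -> form n -> form m -> form p;
  d : forall n, {linear form n -> form n.+1};
  form0_bij : bijective form0;
  form0M : forall a b, form0 (a * b) = wedge (add0n 0) (form0 a) (form0 b);
  wedge_linearl : forall n m p (h : (n + m)%N = p) y, linear ((wedge h)^~ y);
  wedge_linearr : forall n m p (h : (n + m)%N = p) x, linear (wedge h x);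
  wedgeA : forall n m l nm ml p (h1 : (n + m)%N = nm) (h2 : (nm + l)%N = p)
      (h3 : (m + l)%N = ml) (h4 : (n + ml)%N = p) x y z,
    wedge h2 (wedge h1 x y) z = wedge h4 x (wedge h3 y z);
  wedge1l : forall n x, wedge (add0n n) (form0 1) x = x;
  wedge1r : forall n x, wedge (addn0 n) x (form0 1) = x;
  dd : forall n (x : form n), d n.+1 (d n x) = 0;
  d_wedge : forall n m p (h : (n + m)%N = p) (hl : (n.+1 + m)%N = p.+1)
      (hr : (n + m.+1)%N = p.+1) x y,
    d p (wedge h x y) = wedge hl (d n x) y + (-1) ^+ n *: wedge hr x (d m y);
  d_dense : forall n (x : form n.+1), exists s : seq (A * form n),
    x = \sum_(ay <- s) wedge (add0n n.+1) (form0 ay.1) (d n ay.2)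
}.

Variable C : calculus.

Section FormBimodule.
Variable n : nat.
Let la (a : A) (x : form C n) := wedge (add0n n) (form0 C a) x.
Let ra (x : form C n) (a : A) := wedge (addn0 n) x (form0 C a).

Let la_linearl x : linear (la^~ x).
Proof. by move=> c a b; rewrite /la linearP wedge_linearl. Qed.
Let la_linearr a : linear (la a). Proof. exact: wedge_linearr. Qed.
Let la1 x : la 1 x = x. Proof. exact: wedge1l. Qed.
Let laM a b x : la (a * b) x = la a (la b x).
Proof. by rewrite /la form0M; apply: wedgeA. Qed.
Let ra_linearl a : linear (ra^~ a). Proof. exact: wedge_linearl. Qed.
Let ra_linearr x : linear (ra x).
Proof. by move=> c a b; rewrite /ra linearP wedge_linearr. Qed.
Let ra1 x : ra x 1 = x. Proof. exact: wedge1r. Qed.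
Let raM a b x : ra x (a * b) = ra (ra x a) b.
Proof. by rewrite /ra form0M; apply/esym/wedgeA. Qed.
Let lara a b x : la a (ra x b) = ra (la a x) b.
Proof. by apply/esym/wedgeA. Qed.

Definition Omega : bimodule A :=
  @Bimodule k A (LeftModule la_linearl la_linearr la1 laM) ra
    ra_linearl ra_linearr ra1 raM lara.
End FormBimodule.

Definition wedgeO n m p (h : (n + m)%N = p) (x : Omega n) (y : Omega m) :
  Omega p := wedge h x y.
Definition dO n : {linear Omega n -> Omega n.+1} := d C n.
Definition dA (a : A) : Omega 1 := d C 0 (form0 C a).

Lemma wedgeO_linearl n m p (h : (n + m)%N = p) y : linear ((wedgeO h)^~ y).
Proof. exact: wedge_linearl. Qed.
Lemma wedgeO_linearr n m p (h : (n + m)%N = p) x : linear (wedgeO h x).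
Proof. exact: wedge_linearr. Qed.
Lemma wedgeO_ract n m p (h : (n + m)%N = p) x y a :
  wedgeO h x (ract y a) = ract (wedgeO h x y) a.
Proof. exact/esym/wedgeA. Qed.
Lemma wedgeO_lact n m p (h : (n + m)%N = p) x y a :
  wedgeO h (lact a x) y = lact a (wedgeO h x y).
Proof. exact: wedgeA. Qed.
Lemma wedgeO_bal n m p (h : (n + m)%N = p) x y a :
  wedgeO h (ract x a) y = wedgeO h x (lact a y).
Proof. exact: wedgeA. Qed.
Lemma dO_ract n (x : Omega n) a :
  dO n (ract x a) = ract (dO n x) a + (-1) ^+ n *: wedgeO (addn1 n) x (dA a).
Proof.
exact: (d_wedge (addn0 n) (addn0 n.+1) (addn1 n) x (form0 C a)).
Qed.

Section FormTensor.
Variable E : leftModule A.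

(* [wedgel h x] maps y (x) e to (x /\ y) (x) e. *)
Section WedgeL.
Variables (n m p : nat) (h : (n + m)%N = p) (x : Omega n).
Let f (y : Omega m) (e : E) : tens (Omega p) E := tensor (wedgeO h x y) e.
Let f_linearl e : linear (f^~ e).
Proof. by move=> c y z; rewrite /f wedgeO_linearr tensor_linearl. Qed.
Let f_linearr y : linear (f y). Proof. exact: tensor_linearr. Qed.
Let f_bal y a e : f (ract y a) e = f y (lact a e).
Proof. by rewrite /f wedgeO_ract tensorA. Qed.
Definition wedgel : {linear tens (Omega m) E -> tens (Omega p) E} :=
  tens_lift (Balanced f_linearl f_linearr f_bal).
Lemma wedgel_tensor y e : wedgel (tensor y e) = tensor (wedgeO h x y) e.
Proof. exact: tens_liftE. Qed.
End WedgeL.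
Arguments wedgel : simpl never.

Lemma wedgel_linear n m p (h : (n + m)%N = p) u : linear ((wedgel h)^~ u).
Proof.
move=> c x x'; elim/tens_ind: u => [|y e|b u v IHu IHv].
- by rewrite !linear0 addr0.
- by rewrite !wedgel_tensor wedgeO_linearl tensor_linearl.
- by rewrite !linearP IHu IHv /= !scalerDr !scalerA addrACA mulrC.
Qed.

Lemma wedgel_ract n m p (h : (n + m)%N = p) x a u :
  wedgel h (ract x a) u = wedgel h x (lact a u).
Proof.
rewrite -[lact a u]/(tens_lact _ _ a u).
elim/tens_ind: u => [|y e|b u v IHu IHv]; first by rewrite !linear0.
  by rewrite tens_lactE !wedgel_tensor wedgeO_bal.
by rewrite !linearP IHu IHv.
Qed.

Lemma wedgel_lact n m p (h : (n + m)%N = p) x a u :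
  wedgel h (lact a x) u = lact a (wedgel h x u).
Proof.
rewrite -[RHS]/(tens_lact _ _ a (wedgel h x u)).
elim/tens_ind: u => [|y e|b u v IHu IHv]; first by rewrite !linear0.
  by rewrite !wedgel_tensor wedgeO_lact; apply/esym/tens_lactE.
by rewrite !linearP IHu IHv.
Qed.

Record connection := Connection {
  nab :> {linear E -> tens (Omega 1) E};
  nab_lact : forall a e,
    nab (lact a e) = (tensor (dA a) e : tens (Omega 1) E) + lact a (nab e)
}.

Variable nabla : connection.

(* [nablaX n] is nabla^[n], see [nablaX_tensor]. *)
Section Extension.
Variable n : nat.
Let f (x : Omega n) (e : E) : tens (Omega n.+1) E :=
  tensor (dO n x) e + (-1) ^+ n *: wedgel (addn1 n) x (nabla e).
Let f_linearl e : linear (f^~ e).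
Proof.
move=> c x y; rewrite /f linearP tensor_linearl wedgel_linear.
by rewrite !scalerDr !scalerA [c * _]mulrC addrACA.
Qed.
Let f_linearr x : linear (f x).
Proof.
move=> c e e'; rewrite /f !linearP tensor_linearr /=.
by rewrite !scalerDr !scalerA [c * _]mulrC addrACA.
Qed.
Let f_bal x a e : f (ract x a) e = f x (lact a e).
Proof.
rewrite /f nab_lact linearD dO_ract.
rewrite tensorDl tensorA tensorZl wedgel_tensor wedgel_ract.
by rewrite scalerDr addrA.
Qed.
Definition nablaX : {linear tens (Omega n) E -> tens (Omega n.+1) E} :=
  tens_lift (Balanced f_linearl f_linearr f_bal).
Lemma nablaX_tensor x e : nablaX (tensor x e) =
  (tensor (dO n x) e : tens _ _) + (-1) ^+ n *: wedgel (addn1 n) x (nabla e).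
Proof. exact: tens_liftE. Qed.
End Extension.
Arguments nablaX : simpl never.

Definition flat := forall e, nablaX 1 (nabla e) = 0.

Section Cohomology.
Variable n : nat.

Definition is_cocycle : pred (tens (Omega n) E) := fun u => nablaX n u == 0.

Let is_cocycle_closed : submod_closed is_cocycle.
Proof.
split; first by rewrite unfold_in linear0.
move=> c u v; rewrite !unfold_in linearP => /eqP -> /eqP ->.
by rewrite scaler0 addr0.
Qed.
HB.instance Definition _ := GRing.isSubmodClosed.Build k (tens (Omega n) E)
  is_cocycle is_cocycle_closed.

Record cocycle : Type := Cocycle {
  cocycle_val :> tens (Omega n) E;
  cocycleP : cocycle_val \in is_cocycle
}.
HB.instance Definition _ := [isSub for cocycle_val].
HB.instance Definition _ := [Choice of cocycle by <:].
HB.instance Definition _ := [SubChoice_isSubLmodule of cocycle by <:].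
End Cohomology.

Definition coboundary n : tens (Omega n) E -> Prop :=
  match n with
  | 0 => fun u => u = 0
  | n'.+1 => fun u => exists v, u = nablaX n' v
  end.

Definition is_coboundary n : pred (cocycle n) := fun z => `[< coboundary (val z) >].

Lemma is_coboundary_closed n : submod_closed (@is_coboundary n).
Proof.
split=> [|c u v].
  by apply/asboolP; case: n => [|n] //=; exists 0; rewrite linear0.
move=> /asboolP bu /asboolP bv; apply/asboolP; rewrite linearP /=.
case: n u v bu bv => [|n] u v /=; first by move=> -> ->; rewrite scaler0 addr0.
by move=> [u' ->] [v' ->]; exists (c *: u' + v'); rewrite linearP.
Qed.

(* H^n(A, E, nabla): cocycles modulo those that are coboundaries. *)
Definition cohomology n : lmodType k := quotmod (@is_coboundary_closed n).
Definition cohcls n : {linear cocycle n -> cohomology n} :=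
  quotcls (@is_coboundary_closed n).
End FormTensor.
Arguments wedgel : simpl never.
Arguments nablaX : simpl never.

Section Product.
Variable E : nat -> bimodule A.

(* The product on the E^m is only required to be left A-linear, which is what
   the formulas below need in order to be well defined on tensor products. *)
Record product_data := ProductData {
  sigma : forall m n, bimodHom (btens (E m) (Omega n)) (btens (Omega n) (E m));
  eprod : forall m m' q, (m + m')%N = q ->
    lmodHom (tens (E m) (E m')) (E q)
}.

Variable P : product_data.

(* [wedger h x f] is x /\ f: it maps (w (x) e, f) to w (x) (e /\ f). *)
Section WedgeR.
Variables (n m m' q : nat) (h : (m + m')%N = q) (f : E m').
Let g (w : Omega n) (e : E m) : tens (Omega n) (E q) :=
  tensor w (eprod P h (tensor e f)).
Let g_linearl e : linear (g^~ e). Proof. exact: tensor_linearl. Qed.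
Let g_linearr w : linear (g w).
Proof. by move=> c e e'; rewrite /g tensor_linearl linearP tensor_linearr. Qed.
Let g_bal w a e : g (ract w a) e = g w (lact a e).
Proof. by rewrite /g tensorA -lmodHomE lact_tensor. Qed.
Definition wedger : {linear tens (Omega n) (E m) -> tens (Omega n) (E q)} :=
  tens_lift (Balanced g_linearl g_linearr g_bal).
Lemma wedger_tensor w e :
  wedger (tensor w e) = tensor w (eprod P h (tensor e f)).
Proof. exact: tens_liftE. Qed.
End WedgeR.
Arguments wedger : simpl never.

Lemma wedger_linear n m m' q (h : (m + m')%N = q) (u : tens (Omega n) (E m)) :
  linear (fun f => wedger n h f u).
Proof.
move=> c f f'; elim/tens_ind: u => [|w e|b u v IHu IHv].
- by rewrite !linear0 addr0.
- by rewrite !wedger_tensor tensor_linearr linearP tensor_linearr.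
- by rewrite !linearP IHu IHv /= !scalerDr !scalerA addrACA mulrC.
Qed.

Lemma wedger_bal n m m' q (h : (m + m')%N = q)
    (u : btens (Omega n) (E m)) a f :
  wedger n h f (ract u a) = wedger n h (lact a f) u.
Proof.
elim/tens_ind: u => [|w e|b u v IHu IHv].
- by rewrite -[ract _ _]/(tens_ract _ _ a 0) !linear0.
- by rewrite ract_tensor !wedger_tensor tensorA.
- rewrite ract_linearl linearP [in RHS]linearP.
  by congr (_ *: _ + _).
Qed.

Lemma wedger_lact n m m' q (h : (m + m')%N = q)
    (u : tens (Omega n) (E m)) a f :
  wedger n h f (lact a u) = lact a (wedger n h f u).
Proof.
elim/tens_ind: u => [|w e|b u v IHu IHv].
- by rewrite -[lact a 0]/(tens_lact _ _ a 0) !linear0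
    -[lact a 0]/(tens_lact _ _ a 0) linear0.
- by rewrite wedger_tensor !lact_tensor wedger_tensor.
- by rewrite lact_linearr !linearP lact_linearr IHu IHv.
Qed.

(* [sigma_wedge h e y] is (sigma /\ id)(e (x) y): it maps (e, w (x) f) to
   sigma(e (x) w) /\ f. *)
Section SigmaWedge.
Variables (n m m' q : nat) (h : (m + m')%N = q) (e : E m).
Let g (w : Omega n) (f : E m') : tens (Omega n) (E q) :=
  wedger n h f (sigma P m n (tensor e w)).
Let g_linearl f : linear (g^~ f).
Proof. by move=> c w w'; rewrite /g tensor_linearr !linearP. Qed.
Let g_linearr w : linear (g w). Proof. exact: wedger_linear. Qed.
Let g_bal w a f : g (ract w a) f = g w (lact a f).
Proof. by rewrite /g -ract_tensor bimodHomEr wedger_bal. Qed.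
Definition sigma_wedge : {linear tens (Omega n) (E m') -> tens (Omega n) (E q)} :=
  tens_lift (Balanced g_linearl g_linearr g_bal).
Lemma sigma_wedge_tensor w f :
  sigma_wedge (tensor w f) = wedger n h f (sigma P m n (tensor e w)).
Proof. exact: tens_liftE. Qed.
End SigmaWedge.
Arguments sigma_wedge : simpl never.

Lemma sigma_wedge_linear n m m' q (h : (m + m')%N = q)
    (u : tens (Omega n) (E m')) :
  linear (fun e => sigma_wedge n h e u).
Proof.
move=> c e e'; elim/tens_ind: u => [|w f|b u v IHu IHv].
- by rewrite !linear0 addr0.
- by rewrite !sigma_wedge_tensor tensor_linearl !linearP.
- by rewrite !linearP IHu IHv /= !scalerDr !scalerA addrACA mulrC.
Qed.

Lemma sigma_wedge_lact n m m' q (h : (m + m')%N = q)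
    (u : tens (Omega n) (E m')) a e :
  sigma_wedge n h (lact a e) u = lact a (sigma_wedge n h e u).
Proof.
elim/tens_ind: u => [|w f|b u v IHu IHv].
- by rewrite !linear0 -[lact a 0]/(tens_lact _ _ a 0) linear0.
- by rewrite !sigma_wedge_tensor -lact_tensor bimodHomEl wedger_lact.
- by rewrite !linearP lact_linearr IHu IHv.
Qed.

(* [wedge_sigma h y x] is (id /\ sigma)(y (x) x): it maps (w (x) e, x) to
   w /\ sigma(e (x) x). *)
Section WedgeSigma.
Variables (n n' p m : nat) (h : (n + n')%N = p) (y : tens (Omega n) (E m))
  (x : Omega n').
Let g (w : Omega n) (e : E m) : tens (Omega p) (E m) :=
  wedgel (E m) h w (sigma P m n' (tensor e x)).
Let g_linearl e : linear (g^~ e). Proof. exact: wedgel_linear. Qed.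
Let g_linearr w : linear (g w).
Proof. by move=> c e e'; rewrite /g tensor_linearl !linearP. Qed.
Let g_bal w a e : g (ract w a) e = g w (lact a e).
Proof. by rewrite /g wedgel_ract -lact_tensor bimodHomEl. Qed.
Definition wedge_sigma : tens (Omega p) (E m) :=
  tens_lift (Balanced g_linearl g_linearr g_bal) y.
End WedgeSigma.

Lemma wedge_sigma_tensor n n' p m (h : (n + n')%N = p) w (e : E m) x :
  wedge_sigma h (tensor w e) x = wedgel (E m) h w (sigma P m n' (tensor e x)).
Proof. exact: tens_liftE. Qed.

(* The product on Omega^* (x) E^*, see [twedge_tensor]. *)
Section TensorWedge.
Variables (n n' p m m' q : nat) (hn : (n + n')%N = p) (hm : (m + m')%N = q)
  (y : tens (Omega n') (E m')).
Let g (x : Omega n) (e : E m) : tens (Omega p) (E q) :=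
  (-1) ^+ (m * n') *: wedgel (E q) hn x (sigma_wedge n' hm e y).
Let g_linearl e : linear (g^~ e).
Proof.
by move=> c x x'; rewrite /g wedgel_linear scalerDr !scalerA [c * _]mulrC.
Qed.
Let g_linearr x : linear (g x).
Proof.
move=> c e e'; rewrite /g sigma_wedge_linear linearP scalerDr.
by rewrite !scalerA [c * _]mulrC.
Qed.
Let g_bal x a e : g (ract x a) e = g x (lact a e).
Proof. by rewrite /g wedgel_ract sigma_wedge_lact. Qed.
Definition twedger : {linear tens (Omega n) (E m) -> tens (Omega p) (E q)} :=
  tens_lift (Balanced g_linearl g_linearr g_bal).
End TensorWedge.
Arguments twedger : simpl never.

Definition twedge n n' p m m' q (hn : (n + n')%N = p) (hm : (m + m')%N = q)
    (x : tens (Omega n) (E m)) (y : tens (Omega n') (E m')) :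
  tens (Omega p) (E q) := twedger hn hm y x.

Lemma twedge_tensorl n n' p m m' q (hn : (n + n')%N = p) (hm : (m + m')%N = q)
    x (e : E m) y :
  twedge hn hm (tensor x e) y =
  (-1) ^+ (m * n') *: wedgel (E q) hn x (sigma_wedge n' hm e y).
Proof. exact: tens_liftE. Qed.

Lemma twedge_tensor n n' p m m' q (hn : (n + n')%N = p) (hm : (m + m')%N = q)
    x (e : E m) y (f : E m') :
  twedge hn hm (tensor x e) (tensor y f) =
  (-1) ^+ (m * n') *: wedgel (E q) hn x (wedger n' hm f (sigma P m n' (tensor e y))).
Proof. by rewrite twedge_tensorl sigma_wedge_tensor. Qed.

Lemma twedge_linearl n n' p m m' q (hn : (n + n')%N = p) (hm : (m + m')%N = q) y :
  linear (fun x : tens (Omega n) (E m) =>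
    twedge hn hm x (y : tens (Omega n') (E m'))).
Proof. exact: linearP. Qed.

Lemma twedge_linearr n n' p m m' q (hn : (n + n')%N = p) (hm : (m + m')%N = q) x :
  linear (fun y : tens (Omega n') (E m') =>
    twedge hn hm (x : tens (Omega n) (E m)) y).
Proof.
move=> c y y'; elim/tens_ind: x => [|x e|b u v IHu IHv].
- by rewrite /twedge !linear0 addr0.
- by rewrite !twedge_tensorl !linearP.
- rewrite !twedge_linearl IHu IHv !scalerDr !scalerA addrACA.
  by rewrite [b * _]mulrC.
Qed.

Record product_structure (nabla : forall m, connection (E m)) : Prop :=
  ProductStructure {
  twedgeA : forall n1 n2 n3 n12 n23 n m1 m2 m3 m12 m23 m
      (hn12 : (n1 + n2)%N = n12) (hn12_3 : (n12 + n3)%N = n)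
      (hn23 : (n2 + n3)%N = n23) (hn1_23 : (n1 + n23)%N = n)
      (hm12 : (m1 + m2)%N = m12) (hm12_3 : (m12 + m3)%N = m)
      (hm23 : (m2 + m3)%N = m23) (hm1_23 : (m1 + m23)%N = m)
      (x : tens (Omega n1) (E m1)) (y : tens (Omega n2) (E m2))
      (z : tens (Omega n3) (E m3)),
    twedge hn12_3 hm12_3 (twedge hn12 hm12 x y) z =
    twedge hn1_23 hm1_23 x (twedge hn23 hm23 y z);
  (* d (x) id and id /\ nabla are only defined together, as nabla^[n] *)
  nabla_sigma : forall m n (e : E m) (x : Omega n),
    wedge_sigma (add1n n) (nabla m e) x + sigma P m n.+1 (tensor e (dO n x)) =
    nablaX (nabla m) n (sigma P m n (tensor e x));
  nabla_eprod : forall m m' q (h : (m + m')%N = q) (e : E m) (f : E m'),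
    nabla q (eprod P h (tensor e f)) =
    wedger 1 h f (nabla m e) + sigma_wedge 1 h e (nabla m' f);
  sigma_wedgeO : forall m n n' p (h : (n + n')%N = p) (e : E m)
      (x : Omega n) (y : Omega n'),
    wedge_sigma h (sigma P m n (tensor e x)) y =
    sigma P m p (tensor e (wedgeO h x y))
}.

End Product.
End Calculus.

(* Main.v *)
Require Import Defs.
From mathcomp Require Import all_boot all_algebra.
From mathcomp Require Import boolp ring.

(** Write s for sigma. On pure tensors the product is
    (x (x) e) /\ (y (x) f) = (-1)^(|e| |y|) x /\ (s(e (x) y) /\ f),
    so applying nabla^[*] to it means differentiating, in turn, a left
    multiplication by the form x and a right multiplication by the element f:
    - the Leibniz rule of d gives
      nabla(x /\ w) = dx /\ w + (-1)^|x| x /\ nabla w  ([nablaX_wedgel]);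
    - compatibility of nabla with the product of the E^m ([nabla_eprod]) gives
      nabla(u /\ f) = nabla u /\ f +- u /\ nabla f  ([nablaX_wedger]).
    In the second formula u = s(e (x) y), whose derivative [nabla_sigma] gives as
    the sum of (id /\ s)(nabla e (x) y) and s(e (x) dy). This produces four
    terms, carrying dx, nabla e, dy and nabla f respectively. The right-hand
    side of the derivation rule expands into the same four terms: the one with
    nabla f appears there as (s /\ id)(e (x) (y /\ nabla f)), and multiplicativity
    of s in the form ([sigma_wedgeO]) splits off y ([sigma_wedge_wedgel]). What remains is a comparison of signs
    ([nablaX_twedge_tensor]); both sides being bilinear, the rule extends to
    all elements ([nablaX_twedge]).

    The derivation rule makes a product of cocycles a cocycle, and a product of
    a cocycle and a coboundary, in either order, a coboundary. Hence the
    product of representatives defines a bilinear map on cohomology classes,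
    which factors through the tensor product over the ground field. *)

Set Implicit Arguments.
Unset Strict Implicit.
Unset Printing Implicit Defensive.

Import GRing.Theory.
Local Open Scope ring_scope.

(** * Left multiplication by forms *)

Section LeftForms.
Variables (k : fieldType) (A : algType k) (C : calculus A) (E : leftModule A).

Lemma wedgel_wedgeO n m l nm ml p (h1 : (n + m)%N = nm) (h2 : (nm + l)%N = p)
    (h3 : (m + l)%N = ml) (h4 : (n + ml)%N = p)
    (x : Omega C n) (y : Omega C m) (u : tens (Omega C l) E) :
  wedgel E h2 (wedgeO h1 x y) u = wedgel E h4 x (wedgel E h3 y u).
Proof.
elim/tens_ind: u => [|w e|b u v IHu IHv]; first by rewrite !linear0.
  by rewrite !wedgel_tensor; congr tensor; apply: wedgeA.
by rewrite !linearP IHu IHv.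
Qed.

(** The Leibniz rule of d, with a factor in E carried along: the term with nabla
    e matches because (x /\ y) /\ nabla e = x /\ (y /\ nabla e). *)
Lemma nablaX_wedgel (nabla : connection C E) n m p (h : (n + m)%N = p)
    (hl : (n.+1 + m)%N = p.+1) (hr : (n + m.+1)%N = p.+1)
    (x : Omega C n) (u : tens (Omega C m) E) :
  nablaX nabla p (wedgel E h x u) =
  wedgel E hl (dO C n x) u + (-1) ^+ n *: wedgel E hr x (nablaX nabla m u).
Proof.
elim/tens_ind: u => [|w e|b u v IHu IHv].
- by rewrite !linear0 addr0.
- rewrite !wedgel_tensor !nablaX_tensor linearD wedgel_tensor.
  rewrite (wedgel_wedgeO h _ (addn1 m) hr) [dO _ _ _](d_wedge h hl hr).
  rewrite tensorDl tensorZl scalerDr -addrA; congr (_ + (_ + _)).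
  by rewrite linearZ /= scalerA -exprD h.
- by rewrite !linearP IHu IHv /= !scalerDr !scalerA addrACA.
Qed.
End LeftForms.

(** * The product on forms with coefficients *)

Section Product.
Variables (k : fieldType) (A : algType k) (C : calculus A) (E : nat -> bimodule A).
Variable P : product_data C E.

Lemma wedger_wedgel n n' p m m' q (hn : (n + n')%N = p) (hm : (m + m')%N = q)
    (x : Omega C n) (f : E m') (u : tens (Omega C n') (E m)) :
  wedger P p hm f (wedgel (E m) hn x u) = wedgel (E q) hn x (wedger P n' hm f u).
Proof.
elim/tens_ind: u => [|w e|b u v IHu IHv]; first by rewrite !linear0.
  by rewrite wedgel_tensor !wedger_tensor wedgel_tensor.
by rewrite !linearP IHu IHv.
Qed.

Lemma wedge_sigma_linearl n n' p m (h : (n + n')%N = p) (x : Omega C n') :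
  linear (fun u : tens (Omega C n) (E m) => wedge_sigma P h u x).
Proof. by move=> c u v; rewrite /wedge_sigma linearP. Qed.

Lemma twedge_wedgel n1 n2 n12 n3 n23 p m m' q (h12 : (n1 + n2)%N = n12)
    (h12_3 : (n12 + n3)%N = p) (h23 : (n2 + n3)%N = n23)
    (h1_23 : (n1 + n23)%N = p) (hm : (m + m')%N = q) (x : Omega C n1)
    (u : tens (Omega C n2) (E m)) (v : tens (Omega C n3) (E m')) :
  twedge P h12_3 hm (wedgel (E m) h12 x u) v =
  wedgel (E q) h1_23 x (twedge P h23 hm u v).
Proof.
elim/tens_ind: u => [|w e|b u u' IHu IHv]; first by rewrite /twedge !linear0.
  rewrite wedgel_tensor !twedge_tensorl (wedgel_wedgeO h12 _ h23 h1_23).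
  by rewrite [in RHS]linearZ.
by rewrite linearP !twedge_linearl IHu IHv linearP.
Qed.

(** The product with a pure tensor on the right can be computed before the left
    factor is expanded, which is how the factor nabla e enters [nabla_sigma]. *)
Lemma twedge_tensorr n n' p m m' q (hn : (n + n')%N = p) (hm : (m + m')%N = q)
    (u : tens (Omega C n) (E m)) (y : Omega C n') (f : E m') :
  twedge P hn hm u (tensor y f) =
  (-1) ^+ (m * n') *: wedger P p hm f (wedge_sigma P hn u y).
Proof.
elim/tens_ind: u => [|w e|b u v IHu IHv].
- by rewrite /twedge /wedge_sigma !linear0.
- by rewrite twedge_tensor wedge_sigma_tensor wedger_wedgel.
- rewrite twedge_linearl wedge_sigma_linearl linearP IHu IHv.
  by rewrite scalerDr !scalerA [b * _]mulrC.
Qed.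

Lemma twedge0r n n' p m m' q (hn : (n + n')%N = p) (hm : (m + m')%N = q)
    (u : tens (Omega C n) (E m)) : twedge P hn hm u (0 : tens (Omega C n') (E m')) = 0.
Proof.
have := twedge_linearr P hn hm u (- 1) 0 0.
by rewrite scaler0 addr0 scaleN1r addNr.
Qed.

(** * The derivation rule *)

Section Structure.
Variable nabla : forall m, connection C (E m).
Hypothesis HP : product_structure P nabla.

(** By [sigma_wedgeO], e can pass y first and the form in u afterwards. The sign only undoes the one built into the product. *)
Lemma sigma_wedge_wedgel n n' p m m' q (hn : (n + n')%N = p)
    (hm : (m + m')%N = q) (e : E m) (y : Omega C n)
    (u : tens (Omega C n') (E m')) :
  sigma_wedge P p hm e (wedgel (E m') hn y u) =
  (-1) ^+ (m * n') *: twedge P hn hm (sigma P m n (tensor e y)) u.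
Proof.
elim/tens_ind: u => [|w f|b u v IHu IHv].
- by rewrite twedge0r !linear0.
- rewrite wedgel_tensor sigma_wedge_tensor -(sigma_wedgeO HP hn) twedge_tensorr.
  by rewrite scalerA -expr2 sqrr_sign scale1r.
- by rewrite !linearP IHu IHv twedge_linearr scalerDr !scalerA [b * _]mulrC.
Qed.

(** On pure tensors w (x) e this is [nabla_eprod]. The part (sigma /\ id)(e (x) nabla f)
    of nabla(e /\ f), multiplied by w, is the product of w (x) e with nabla f up
    to the sign (-1)^m coming from the degree 1 of nabla f, which turns
    (-1)^n into (-1)^(n + m). *)
Lemma nablaX_wedger n m m' q (hm : (m + m')%N = q) (f : E m')
    (u : tens (Omega C n) (E m)) :
  nablaX (nabla q) n (wedger P n hm f u) =
  wedger P n.+1 hm f (nablaX (nabla m) n u) +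
  (-1) ^+ (n + m) *: twedge P (addn1 n) hm u (nabla m' f).
Proof.
elim/tens_ind: u => [|w e|b u v IHu IHv].
- by rewrite /twedge !linear0 addr0.
- rewrite wedger_tensor !nablaX_tensor (nabla_eprod HP) !linearD /=.
  rewrite wedger_tensor addrA linearZ /= wedger_wedgel.
  by rewrite twedge_tensorl muln1 scalerA exprD -mulrA -expr2 sqrr_sign mulr1.
- rewrite !linearP IHu IHv twedge_linearl /= !scalerDr !scalerA addrACA.
  by rewrite [b * (-1) ^+ _]mulrC.
Qed.

(** The four terms of the expansion, in the order dx, nabla e, dy, nabla f, are
    brought to a common shape; the signs agree because (-1)^m squares to 1. *)
Lemma nablaX_twedge_tensor n n' p m m' q (hn : (n + n')%N = p)
    (hl : (n.+1 + n')%N = p.+1) (hr : (n + n'.+1)%N = p.+1)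
    (hm : (m + m')%N = q)
    (x : Omega C n) (e : E m) (y : Omega C n') (f : E m') :
  nablaX (nabla q) p (twedge P hn hm (tensor x e) (tensor y f)) =
  twedge P hl hm (nablaX (nabla m) n (tensor x e)) (tensor y f) +
  (-1) ^+ (n + m) *:
    twedge P hr hm (tensor x e) (nablaX (nabla m') n' (tensor y f)).
Proof.
have twl (w w' : tens (Omega C n.+1) (E m)) z (c : k) :
    twedge P hl hm (w + c *: w') z =
    twedge P hl hm w z + c *: twedge P hl hm w' z.
  by rewrite addrC twedge_linearl addrC.
have twr (w w' : tens (Omega C n'.+1) (E m')) z (c : k) :
    twedge P hr hm z (w + c *: w') =
    twedge P hr hm z w + c *: twedge P hr hm z w'.
  by rewrite addrC twedge_linearr addrC.
rewrite twedge_tensor linearZ /= (nablaX_wedgel _ hn hl hr).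
rewrite (nablaX_wedger hm f (sigma P m n' (tensor e y))) -(nabla_sigma HP e y).
rewrite (nablaX_tensor (nabla m) x e) (nablaX_tensor (nabla m') y f) twl twr.
rewrite (twedge_wedgel _ _ (add1n n') hr) !twedge_tensor twedge_tensorr.
rewrite twedge_tensorl (sigma_wedge_wedgel (addn1 n')).
rewrite !linearD !linearZ /= ?scalerDr !scalerA -!addrA.
congr (_ + (_ *: _ + (_ *: _ + _ *: _))).
- exact: mulrC.
- rewrite mulnS !exprD -(signr_odd _ m).
  by case: odd; rewrite ?expr0 ?expr1; ring.
- rewrite muln1 mulnS !exprD -(signr_odd _ m).
  by case: odd; rewrite ?expr0 ?expr1; ring.
Qed.

Lemma nablaX_twedge n n' p m m' q (hn : (n + n')%N = p)
    (hl : (n.+1 + n')%N = p.+1) (hr : (n + n'.+1)%N = p.+1)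
    (hm : (m + m')%N = q)
    (u : tens (Omega C n) (E m)) (v : tens (Omega C n') (E m')) :
  nablaX (nabla q) p (twedge P hn hm u v) =
  twedge P hl hm (nablaX (nabla m) n u) v +
  (-1) ^+ (n + m) *: twedge P hr hm u (nablaX (nabla m') n' v).
Proof.
elim/tens_ind: u => [|x e|b u u' IHu IHu'].
- by rewrite /twedge !linear0 addr0.
- elim/tens_ind: v => [|y f|b v v' IHv IHv'].
  + by rewrite !linear0 !twedge0r !linear0 addr0.
  + exact: nablaX_twedge_tensor.
  + rewrite !twedge_linearr !linearP IHv IHv' !twedge_linearr.
    rewrite !scalerDr !scalerA addrACA.
    by rewrite [b * _]mulrC.
- rewrite !linearP !twedge_linearl !linearP IHu IHu'.
  by rewrite !scalerDr !scalerA addrACA [b * _]mulrC.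
Qed.

(** * The product on cohomology *)

Lemma cohcls_ind l s (Q : cohomology (nabla s) l -> Prop) :
  (forall u, Q (cohcls (nabla s) l u)) -> forall x, Q x.
Proof. by move=> Qu; elim/quotmod_ind. Qed.

Lemma cohcls_eqP l s (u v : cocycle (nabla s) l) :
  cohcls (nabla s) l u = cohcls (nabla s) l v <->
  coboundary (nabla s) (cocycle_val u - cocycle_val v).
Proof.
rewrite -[cocycle_val u - _]/(val (u - v)).
split; first by move=> /quotclsP /asboolP.
by move=> h; apply/quotclsP/asboolP.
Qed.

Section Cup.
Variables (n n' p m m' q : nat) (hn : (n + n')%N = p) (hm : (m + m')%N = q).

Lemma twedge_is_cocycle (u : cocycle (nabla m) n) (v : cocycle (nabla m') n') :
  twedge P hn hm (cocycle_val u) (cocycle_val v) \in @is_cocycle _ _ _ _ (nabla q) p.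
Proof.
have hl : (n.+1 + n')%N = p.+1 by rewrite addSn hn.
have hr : (n + n'.+1)%N = p.+1 by rewrite addnS hn.
have /eqP u0 := cocycleP u; have /eqP v0 := cocycleP v.
rewrite unfold_in (nablaX_twedge hn hl hr hm) u0 v0 twedge0r scaler0 addr0.
by rewrite /twedge linear0.
Qed.

Definition cup_cocycle u v : cocycle (nabla q) p := Cocycle (twedge_is_cocycle u v).

(** If u = nabla w then u /\ v = nabla(w /\ v), since nabla v = 0. For n = 0
    only u = 0 is a coboundary, and the product is 0. *)
Lemma coboundary_twedgel (u : tens (Omega C n) (E m)) (v : cocycle (nabla m') n') :
  coboundary (nabla m) u ->
  coboundary (nabla q) (twedge P hn hm u (cocycle_val v)).
Proof.
have /eqP v0 := cocycleP v.
case: n hn u => [|n1] h u /=.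
  move=> ->; rewrite /twedge linear0; move: p h; case=> //= p1 _.
  by exists 0; rewrite linear0.
case=> w ->; move: p h; case=> //= p1 h.
have h' : (n1 + n')%N = p1 by apply: succn_inj.
have hr : (n1 + n'.+1)%N = p1.+1 by rewrite addnS h'.
exists (twedge P h' hm w (cocycle_val v)).
by rewrite (nablaX_twedge h' h hr) v0 twedge0r scaler0 addr0.
Qed.

(** If v = nabla w then u /\ v = (-1)^(n + m) nabla(u /\ w), since nabla u = 0. *)
Lemma coboundary_twedger (u : cocycle (nabla m) n) (v : tens (Omega C n') (E m')) :
  coboundary (nabla m') v ->
  coboundary (nabla q) (twedge P hn hm (cocycle_val u) v).
Proof.
have /eqP u0 := cocycleP u.
case: n' hn v => [|n1] h v /=.
  move=> ->; rewrite twedge0r; move: p h; case=> //= p1 _.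
  by exists 0; rewrite linear0.
case=> w ->; move: p h; case=> //= [|p1] h; first by have := h; rewrite addnS.
have h' : (n + n1)%N = p1 by apply: succn_inj; rewrite -addnS.
have hl : (n.+1 + n1)%N = p1.+1 by rewrite addSn h'.
exists ((-1) ^+ (n + m) *: twedge P h' hm (cocycle_val u) w).
rewrite linearZ /= (nablaX_twedge h' hl h) u0 {2}/twedge linear0 add0r.
by rewrite scalerA -expr2 sqrr_sign scale1r.
Qed.

(** The product of chosen representatives; [cup_funE] frees it from the choice. *)
Definition cup_fun (x : cohomology (nabla m) n) (y : cohomology (nabla m') n') :
    cohomology (nabla q) p :=
  cohcls (nabla q) p (cup_cocycle (repr x) (repr y)).

(** The two representatives are changed one after the other, through the class of
    u /\ v', and each change adds a coboundary. *)
Lemma cup_funE u v :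
  cup_fun (cohcls (nabla m) n u) (cohcls (nabla m') n' v) =
  cohcls (nabla q) p (cup_cocycle u v).
Proof.
rewrite /cup_fun; set u' := repr _; set v' := repr _.
have /cohcls_eqP bu : cohcls (nabla m) n u' = cohcls (nabla m) n u by apply: quotclsK.
have /cohcls_eqP bv : cohcls (nabla m') n' v' = cohcls (nabla m') n' v by apply: quotclsK.
transitivity (cohcls (nabla q) p (cup_cocycle u v')); apply/cohcls_eqP => /=.
  by rewrite /twedge -linearB; apply: coboundary_twedgel.
have := twedge_linearr P hn hm (cocycle_val u) (-1) (cocycle_val v) (cocycle_val v').
rewrite !scaleN1r ![- _ + _]addrC => <-.
exact: coboundary_twedger.
Qed.

Lemma cup_linearl y : linear (cup_fun^~ y).
Proof.
move=> c; elim/cohcls_ind: y => v; elim/cohcls_ind=> u; elim/cohcls_ind=> u'.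
rewrite -linearP !cup_funE -linearP; congr (cohcls _ _ _); apply: val_inj => /=.
exact: twedge_linearl.
Qed.

Lemma cup_linearr x : linear (cup_fun x).
Proof.
move=> c; elim/cohcls_ind: x => u; elim/cohcls_ind=> v; elim/cohcls_ind=> v'.
rewrite -linearP !cup_funE -linearP; congr (cohcls _ _ _); apply: val_inj => /=.
exact: twedge_linearr.
Qed.

Lemma cup_bal (x : vect (cohomology (nabla m) n)) (c : k^o)
    (y : vect (cohomology (nabla m') n')) :
  cup_fun (ract x c) y = cup_fun x (lact c y).
Proof.
have /= -> := GRing.scalable_linear (cup_linearr x) c y.
exact: (GRing.scalable_linear (cup_linearl y) c x).
Qed.

Definition cup :
    {linear tensk (cohomology (nabla m) n) (cohomology (nabla m') n') ->
            cohomology (nabla q) p} :=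
  tens_lift (@Balanced k k^o (vect (cohomology (nabla m) n))
    (vect (cohomology (nabla m') n')) _ cup_fun cup_linearl cup_linearr cup_bal).

Lemma cupE x y : cup (tensork x y) = cup_fun x y.
Proof. exact: tens_liftE. Qed.
End Cup.
End Structure.
End Product.

Theorem proposition6p9 (k : fieldType) (A : algType k) (C : calculus A)
    (E : nat -> bimodule A) (nabla : forall m, connection C (E m))
    (flat_nabla : forall m, flat (nabla m))
    (P : product_data C E) (HP : product_structure P nabla) :
  (forall n m n' m' (x : tens (Omega C n) (E m)) (y : tens (Omega C n') (E m')),
     nablaX (nabla (m + m')%N) (n + n') (twedge P erefl erefl x y) =
     twedge P (addSn n n') erefl (nablaX (nabla m) n x) y +
     (-1) ^+ (n + m) *: twedge P (addnS n n') erefl x (nablaX (nabla m') n' y))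
  /\
  (forall n m n' m',
     exists cup : {linear tensk (cohomology (nabla m) n) (cohomology (nabla m') n')
                          -> cohomology (nabla (m + m')%N) (n + n')},
       forall (x : cocycle (nabla m) n) (y : cocycle (nabla m') n'),
         exists2 z : cocycle (nabla (m + m')%N) (n + n'),
           cocycle_val z = twedge P erefl erefl (cocycle_val x) (cocycle_val y) &
           cup (tensork (cohcls (nabla m) n x) (cohcls (nabla m') n' y)) =
           cohcls (nabla (m + m')%N) (n + n') z).
Proof.
split=> [n m n' m' x y|n m n' m']; first exact: nablaX_twedge.
exists (cup HP erefl erefl) => x y; exists (cup_cocycle HP erefl erefl x y) => //.
by rewrite cupE cup_funE.
Qed.
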